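(* Let $C\subseteq\mathbb{F}_q^n$ be a linear code that contains its dual code, $C^\perp\subseteq C$, and let $A\subseteq\{1,\ldots,n\}$ be any choice of columns of a generator matrix of $C$. Then $2r(A)\ge |A|$, where $r(A)$ is the rank of the chosen columns. In the special case that $C$ is self-dual, $C=C^\perp$, equality $2r(A)=|A|$ holds if and only if $C=C_1\oplus C_2$ for self-dual codes $C_1$ and $C_2$ that are supported on $A$ and on the complement of $A$, respectively.
   Context: $\mathbb{F}_q$ is the finite field with $q$ elements. A linear code of length $n$ is a linear subspace $C\subseteq\mathbb{F}_q^n$; its dual $C^\perp$ is the orthogonal complement for the standard inner product. A generator matrix of $C$ is a matrix whose rows form a basis of $C$. For a set $A\subseteq\{1,\ldots,n\}$ of column positions, $r(A)$ is the rank of the submatrix of a generator matrix formed by the columns indexed by $A$ (independent of the choice of generator matrix). A code is supported on $A$ if all its words vanish outside $A$; such a code is called self-dual if, regarded as a code of length $|A|$ with coordinates indexed by $A$, it equals its own dual in $\mathbb{F}_q^A$ (for $A=\emptyset$ the zero code is self-dual). *)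

(* Defs.v *)
From mathcomp Require Import all_boot all_order all_algebra.

Set Implicit Arguments.
Unset Strict Implicit.
Unset Printing Implicit Defensive.

Import GRing.Theory.
Local Open Scope ring_scope.

Definition dual_code (F : finFieldType) (n : nat) (C : {vspace 'rV[F]_n}) :
    {vspace 'rV[F]_n} :=
  (\bigcap_(y : 'rV[F]_n | y \in C) lker (linfun (mulmxr y^T)))%VS.

Lemma dual_codeP (F : finFieldType) (n : nat) (C : {vspace 'rV[F]_n})
    (x : 'rV[F]_n) :
  reflect (forall y, y \in C -> \sum_(i < n) x 0 i * y 0 i = 0)
          (x \in dual_code C).
Proof.
have dotE (y : 'rV[F]_n) : (x *m y^T == 0) = (\sum_(i < n) x 0 i * y 0 i == 0).
  have E0 : (x *m y^T) 0 0 = \sum_(i < n) x 0 i * y 0 i.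
    by rewrite mxE; under eq_bigr do rewrite mxE.
  rewrite -E0; apply/eqP/eqP => [-> | H]; first by rewrite mxE.
  by apply/matrixP => i j; rewrite !ord1 H mxE.
rewrite memvE; apply: (iffP subv_bigcapP) => [H y Cy | H y Cy].
  by apply/eqP; rewrite -dotE; move: (H y Cy); rewrite -memvE memv_ker lfunE.
by rewrite -memvE memv_ker lfunE /= dotE H.
Qed.

Definition generator_matrix (F : finFieldType) (n k : nat)
    (C : {vspace 'rV[F]_n}) (G : 'M[F]_(k, n)) : bool :=
  basis_of C [seq row i G | i : 'I_k].

(* [enum_val] lists the positions of [A] in increasing order. *)
Definition columns (R : Type) (m n : nat) (A : {set 'I_n})
    (M : 'M[R]_(m, n)) : 'M[R]_(m, #|A|) :=
  colsub (fun j : 'I_#|A| => enum_val j) M.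

Definition supported_on (F : finFieldType) (n : nat) (A : {set 'I_n})
    (C : {vspace 'rV[F]_n}) : Prop :=
  forall x, x \in C -> forall i, i \notin A -> x 0 i = 0.

(* [C] regarded as a code of length [#|A|]. *)
Definition code_on (F : finFieldType) (n : nat) (A : {set 'I_n})
    (C : {vspace 'rV[F]_n}) : {vspace 'rV[F]_#|A|} :=
  (linfun (@columns F 1 n A) @: C)%VS.

Lemma code_onP (F : finFieldType) (n : nat) (A : {set 'I_n})
    (C : {vspace 'rV[F]_n}) (x : 'rV[F]_#|A|) :
  reflect (exists2 y, y \in C & x = columns A y) (x \in code_on A C).
Proof.
have linE y : linfun (@columns F 1 n A) y = columns A y.
  exact: (lfunE (mxsub id (fun j : 'I_#|A| => enum_val j)) y).
by apply: (iffP memv_imgP) => -[y Cy ->]; exists y; rewrite ?linE.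
Qed.

Definition self_dual (F : finFieldType) (n : nat) (C : {vspace 'rV[F]_n}) :
    Prop :=
  C = dual_code C.

Definition self_dual_on (F : finFieldType) (n : nat) (A : {set 'I_n})
    (C : {vspace 'rV[F]_n}) : Prop :=
  supported_on A C /\ self_dual (code_on A C).

(* Main.v *)
(** Let [P] be the restriction of [C] to the coordinates in [A], so that
    [dim P = r(A)] and [dim P^⊥ = |A| - r(A)]. Extending a word of [P^⊥] by zero
    gives a word of [C^⊥], hence of [C]; so [P^⊥ <= P], which is the inequality.
    When [C] is self-dual, equality means [P = P^⊥]; then the zero extension of
    the restriction of any codeword is again a codeword, so [C] splits as the
    sum of its words supported on [A] and of those supported off [A]. *)
Require Import Defs.
From mathcomp Require Import all_boot all_order all_algebra.

Set Implicit Arguments.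
Unset Strict Implicit.
Unset Printing Implicit Defensive.

Import GRing.Theory.
Local Open Scope ring_scope.

Lemma mem_generator_matrix (F : finFieldType) (n k : nat)
    (C : {vspace 'rV[F]_n}) (G : 'M[F]_(k, n)) (x : 'rV[F]_n) :
  generator_matrix C G -> (x \in C) = (x <= G)%MS.
Proof.
move=> /andP[/eqP <- _]; apply/idP/submxP => [|[u ->]].
  rewrite span_def big_map big_enum => /memv_sumP[v v_row ->].
  elim/big_ind: _ => [|_ _ [u ->] [w ->]|i _]; first by exists 0; rewrite mul0mx.
    by exists (u + w); rewrite mulmxDl.
  have /vlineP[a ->] := v_row i isT.
  by exists (a *: delta_mx 0 i); rewrite -scalemxAl -rowE.
rewrite mulmx_sum_row memv_suml // => i _; rewrite memvZ // memv_span //.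
exact: image_f.
Qed.

(** The rows of [M] may be dependent, as they can be for [columns A G], so the basis of [W] is taken
    from [row_base M], whose [\rank M] rows are free. *)
Lemma dimv_row_space (F : finFieldType) (n k : nat)
    (W : {vspace 'rV[F]_n}) (M : 'M[F]_(k, n)) :
  (forall x, (x \in W) = (x <= M)%MS) -> \dim W = \rank M.
Proof.
move=> memW; pose X := [tuple row i (row_base M) | i < \rank M].
suff /size_basis -> : basis_of W X by [].
have X_i (i : 'I_(\rank M)) : X`_i = row i (row_base M).
  by rewrite -tnth_nth tnth_mktuple.
apply/andP; split; last first.
  apply/freeP => a; under eq_bigr do rewrite X_i.
  have -> : \sum_i a i *: row i (row_base M) = (\row_i a i) *m row_base M.
    by rewrite mulmx_sum_row; apply: eq_bigr => i _; rewrite mxE.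
  move/eqP; rewrite mulmx_free_eq0 ?row_base_free // => /eqP a0 i.
  by move/rowP/(_ i): a0; rewrite !mxE.
rewrite eqEsubv; apply/andP; split.
  apply/span_subvP => _ /mapP[i _ ->].
  by rewrite memW (submx_trans (row_sub i _)) // eq_row_base.
apply/subvP => x; rewrite memW -(eq_row_base M) => /submxP[u ->].
rewrite mulmx_sum_row memv_suml // => i _; rewrite memvZ // memv_span //.
exact: image_f.
Qed.

(** Orthogonality to [W] need only be tested on the rows of [M], so the dual is the left kernel of
    [M^T]; rank-nullity gives its dimension. *)
Lemma dimv_dual_code (F : finFieldType) (n k : nat)
    (W : {vspace 'rV[F]_n}) (M : 'M[F]_(k, n)) :
  (forall x, (x \in W) = (x <= M)%MS) ->
  \dim (dual_code W) = (n - \rank M)%N.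
Proof.
move=> memW; rewrite -(mxrank_tr M) -mxrank_ker; apply: dimv_row_space => x.
apply/dual_codeP/sub_kermxP => [xW | xM y].
  apply/rowP => j; rewrite mxE [RHS]mxE -[RHS](xW (row j M)).
    by apply: eq_bigr => i _; rewrite !mxE.
  by rewrite memW row_sub.
rewrite memW => /submxP[u ->].
have: (x *m (u *m M)^T) 0 0 = 0 by rewrite trmx_mul mulmxA xM mul0mx mxE.
by move=> xMy; rewrite -[RHS]xMy mxE; apply: eq_bigr => i _; rewrite [in RHS]mxE.
Qed.

(** Selecting columns commutes with left multiplication by a coefficient row. This identifies r(A)
    with the dimension of the restricted code. *)
Lemma mem_code_on (F : finFieldType) (n k : nat) (C : {vspace 'rV[F]_n})
    (G : 'M[F]_(k, n)) (A : {set 'I_n}) (x : 'rV[F]_#|A|) :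
  generator_matrix C G -> (x \in code_on A C) = (x <= columns A G)%MS.
Proof.
move=> genG; apply/code_onP/submxP => [[y] | [u ->]].
  rewrite (mem_generator_matrix _ genG) => /submxP[u ->] ->; exists u.
  by apply/rowP => j; rewrite !mxE; apply: eq_bigr => i _; rewrite !mxE.
exists (u *m G); first by rewrite (mem_generator_matrix _ genG) submxMl.
by apply/rowP => j; rewrite !mxE; apply: eq_bigr => i _; rewrite !mxE.
Qed.

Lemma dot_columns (F : finFieldType) (n : nat) (A : {set 'I_n})
    (x y : 'rV[F]_n) :
  (forall i, i \notin A -> x 0 i = 0) ->
  \sum_(j < #|A|) columns A x 0 j * columns A y 0 j =
  \sum_(i < n) x 0 i * y 0 i.
Proof.
move=> xA; under eq_bigr do rewrite !mxE.
rewrite -(big_enum_val (fun i => x 0 i * y 0 i)) [RHS](bigID (mem A)) /=.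
by rewrite [X in _ + X]big1 ?addr0 // => i /xA ->; rewrite mul0r.
Qed.

(** As [enum_val] is injective with image [A], the sum has one term for [i] in [A] and none
    otherwise, so no case split or default index is needed. *)
Definition zero_extension (F : finFieldType) (n : nat) (A : {set 'I_n})
    (v : 'rV[F]_#|A|) : 'rV[F]_n :=
  \row_i \sum_(j | enum_val j == i) v 0 j.

Lemma columns_zero_extension (F : finFieldType) (n : nat) (A : {set 'I_n})
    (v : 'rV[F]_#|A|) :
  columns A (zero_extension v) = v.
Proof.
apply/rowP => j; rewrite !mxE (big_pred1 j) // => l.
by rewrite (inj_eq enum_val_inj).
Qed.

Lemma zero_extension_out (F : finFieldType) (n : nat) (A : {set 'I_n})
    (v : 'rV[F]_#|A|) i :
  i \notin A -> zero_extension v 0 i = 0.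
Proof.
move=> iA; rewrite mxE big_pred0 // => j; apply: contraNF iA => /eqP <-.
exact: enum_valP.
Qed.

(** The product of the extension with a word of [C] only sees [A], where it is the product of [v]
    with the restricted word. *)
Lemma zero_extension_dual (F : finFieldType) (n : nat) (A : {set 'I_n})
    (C : {vspace 'rV[F]_n}) (v : 'rV[F]_#|A|) :
  v \in dual_code (code_on A C) -> zero_extension v \in dual_code C.
Proof.
move=> /dual_codeP vP; apply/dual_codeP => y Cy.
rewrite -(dot_columns _ (@zero_extension_out _ _ _ v)) columns_zero_extension.
by apply: vP; apply/code_onP; exists y.
Qed.

Lemma dual_code_on_sub (F : finFieldType) (n : nat) (A : {set 'I_n})
    (C : {vspace 'rV[F]_n}) :
  (dual_code C <= C)%VS -> (dual_code (code_on A C) <= code_on A C)%VS.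
Proof.
move=> /subvP dualC; apply/subvP => v /zero_extension_dual/dualC Cv.
by apply/code_onP; exists (zero_extension v); rewrite ?columns_zero_extension.
Qed.

Lemma code_on_addl (F : finFieldType) (n : nat) (A : {set 'I_n})
    (C1 C2 : {vspace 'rV[F]_n}) :
  supported_on (~: A) C2 -> code_on A (C1 + C2)%VS = code_on A C1.
Proof.
move=> suppC2.
suff C2_0 : code_on A C2 = 0%VS.
  by rewrite /code_on limgD -/(code_on A C2) C2_0 addv0.
apply/eqP; rewrite -subv0; apply/subvP => _ /code_onP[y C2y ->]; rewrite memv0.
apply/eqP/rowP => j; rewrite !mxE (suppC2 y) // in_setC negbK.
exact: enum_valP.
Qed.

Lemma self_dual_on_summand (F : finFieldType) (n : nat) (A : {set 'I_n})
    (C1 C2 : {vspace 'rV[F]_n}) :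
  self_dual (C1 + C2)%VS -> supported_on A C1 -> supported_on (~: A) C2 ->
  self_dual_on A C1.
Proof.
move=> sdC suppC1 suppC2; split=> //; apply/eqP; rewrite eqEsubv.
rewrite -(code_on_addl C1 suppC2) dual_code_on_sub -?sdC // andbT.
(* Only the left-hand code goes back to [C1]: its words are supported on [A], as [dot_columns]
   requires, and are orthogonal to the whole sum. *)
rewrite {1}(code_on_addl C1 suppC2).
apply/subvP => _ /code_onP[y C1y ->]; apply/dual_codeP => _ /code_onP[w Cw ->].
rewrite dot_columns; last exact: suppC1.
have /subvP/(_ y C1y) : (C1 <= C1 + C2)%VS by exact: addvSl.
by rewrite sdC => /dual_codeP; apply.
Qed.

(** The shortening of [C] at [B], with the zero coordinates kept. *)
Definition vanishing (F : finFieldType) (n : nat) (B : {set 'I_n})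
    (C : {vspace 'rV[F]_n}) : {vspace 'rV[F]_n} :=
  (C :&: lker (linfun (@columns F 1 n B)))%VS.

Lemma vanishingP (F : finFieldType) (n : nat) (B : {set 'I_n})
    (C : {vspace 'rV[F]_n}) (x : 'rV[F]_n) :
  reflect (x \in C /\ forall i, i \in B -> x 0 i = 0) (x \in vanishing B C).
Proof.
have linE : linfun (@columns F 1 n B) x = columns B x.
  exact: (lfunE (mxsub id (fun j : 'I_#|B| => enum_val j)) x).
rewrite memv_cap memv_ker linE.
apply: (iffP andP) => -[Cx xB]; split=> //.
  move=> i iB; move/eqP/rowP/(_ (enum_rank_in iB i)): xB.
  by rewrite !mxE enum_rankK_in.
by apply/eqP/rowP => j; rewrite !mxE xB // enum_valP.
Qed.

Lemma supported_vanishing (F : finFieldType) (n : nat) (A : {set 'I_n})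
    (C : {vspace 'rV[F]_n}) :
  supported_on A (vanishing (~: A) C).
Proof. by move=> x /vanishingP[_ xA] i iA; rewrite xA // in_setC. Qed.

Lemma directv_disjoint_support (F : finFieldType) (n : nat) (A : {set 'I_n})
    (C1 C2 : {vspace 'rV[F]_n}) :
  supported_on A C1 -> supported_on (~: A) C2 -> directv (C1 + C2).
Proof.
move=> suppC1 suppC2; apply/directv_addP/eqP; rewrite -subv0.
apply/subvP => x; rewrite memv_cap memv0 => /andP[C1x C2x].
apply/eqP/rowP => i; rewrite [RHS]mxE; have [iA|iA] := boolP (i \in A).
  by rewrite (suppC2 x) // in_setC negbK.
exact: (suppC1 x).
Qed.

(** A codeword [c] splits as [e + (c - e)], where [e] keeps its entries on [A] and is zero
    elsewhere. Self-duality on [A] puts [e] in the dual of [C], which is [C]. *)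
Lemma vanishing_decomposition (F : finFieldType) (n : nat) (A : {set 'I_n})
    (C : {vspace 'rV[F]_n}) :
  self_dual C -> self_dual (code_on A C) ->
  C = (vanishing (~: A) C + vanishing A C)%VS.
Proof.
move=> sdC sdP; apply/eqP; rewrite eqEsubv subv_add !capvSl !andbT.
apply/subvP => c Cc; pose e := zero_extension (columns A c).
have Ce : e \in C.
  rewrite sdC zero_extension_dual // -sdP.
  by apply/code_onP; exists c.
rewrite -(subrK e c) addrC memv_add //; apply/vanishingP; split=> //.
- by move=> i; rewrite in_setC; exact: zero_extension_out.
- exact: rpredB.
move=> i iA; have /rowP/(_ (enum_rank_in iA i)) := columns_zero_extension (columns A c).
by rewrite !mxE !enum_rankK_in // => ->; rewrite subrr.
Qed.

Theorem proposition2 (F : finFieldType) (n k : nat) (C : {vspace 'rV[F]_n})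
    (G : 'M[F]_(k, n)) (A : {set 'I_n}) :
  generator_matrix C G ->
  (dual_code C <= C)%VS ->
  (#|A| <= 2 * \rank (columns A G))%N /\
  (self_dual C ->
   ((2 * \rank (columns A G))%N = #|A| <->
    exists C1 C2 : {vspace 'rV[F]_n},
      [/\ self_dual_on A C1, self_dual_on (~: A) C2,
          C = (C1 + C2)%VS & directv (C1 + C2)])).
Proof.
move=> genG dualC.
have memP x : (x \in code_on A C) = (x <= columns A G)%MS.
  exact: mem_code_on.
have dimP := dimv_row_space memP; have dimPd := dimv_dual_code memP.
have dualP := dual_code_on_sub A dualC.
split=> [|sdC].
  by have := dimvS dualP; rewrite dimP dimPd leq_subLR addnn mul2n.
split=> [eqA | [C1 [C2 [[suppC1 sdC1] [suppC2 _] defC _]]]]; last first.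
  (* Words of [C2] vanish on [A], so [C] and [C1] have the same restriction to [A]. Its self-duality
     gives r(A) = |A| - r(A). *)
  have sdP : self_dual (code_on A C) by rewrite defC code_on_addl.
  rewrite -[in LHS]dimP mul2n -addnn {1}sdP dimP dimPd.
  by rewrite subnK // rank_leq_col.
have sdP : self_dual (code_on A C).
  (* Given the inclusion of the dual, it remains to compare dimensions; [rank_leq_col] keeps the
     subtraction |A| - r(A) from truncating. *)
  apply/esym/eqP; rewrite eqEdim dualP dimP dimPd.
  by rewrite leq_subRL ?rank_leq_col //= addnn -mul2n eqA leqnn.
have defC := vanishing_decomposition sdC sdP.
have supp1 : supported_on A (vanishing (~: A) C) := @supported_vanishing _ _ _ _.
have supp2 : supported_on (~: A) (vanishing A C).
  by have := @supported_vanishing _ _ (~: A) C; rewrite setCK.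
exists (vanishing (~: A) C), (vanishing A C); split=> //.
- by apply: self_dual_on_summand supp1 supp2; rewrite -defC.
(* The same lemma with [A] and its complement exchanged. *)
- apply: (self_dual_on_summand (C2 := vanishing (~: A) C)) => //.
    by rewrite addvC -defC.
  by rewrite setCK.
- exact: directv_disjoint_support supp1 supp2.
Qed.
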